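(* If $(A,\mathfrak m)$ is a UFD of dimension $d\ge 2$ and the associated graded ring $G_{\mathfrak m}(A)=\bigoplus_{n\ge 0}\mathfrak m^n/\mathfrak m^{n+1}$ is a domain, then $\alpha(A)=1$.
   Context: Here $(A,\mathfrak m)$ is either a Noetherian local ring with maximal ideal $\mathfrak m$, or a standard graded algebra over a field with irrelevant graded maximal ideal $\mathfrak m$. For a finitely generated $A$-module $M$, $\operatorname{Ass}^{(i)}_A(M)$ denotes the set of associated primes of $M$ of height $i$, and $\sharp$ denotes cardinality. For an $A$-regular element $x\in\mathfrak m^s\setminus\mathfrak m^{s+1}$ (taken homogeneous in the graded case) set $A_s(x)=\sharp\operatorname{Ass}^{(1)}_A(A/(x))$. Set $\alpha_A(s)=\sup\{A_s(x)\mid x\in\mathfrak m^s\setminus\mathfrak m^{s+1}\text{ is } A\text{-regular (and homogeneous in the graded case)}\}$ and $\alpha(A)=\limsup_{s\to\infty}\alpha_A(s)/s$.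
   Formalization: In the graded case the base field is assumed infinite: over a finite field there are finitely many forms of each degree, so α(A)=0 (for instance A=F_2[x,y]) and the claim fails; the local case is unrestricted. *)

(* Defs.v *)
From HB Require Import structures.
From mathcomp Require Import all_boot all_order all_algebra.
From mathcomp Require Import generic_quotient ring_quotient.
From mathcomp Require Import all_classical all_reals all_analysis.

Set Implicit Arguments.
Unset Strict Implicit.
Unset Printing Implicit Defensive.

Import Order.TTheory GRing.Theory Num.Theory.

Local Open Scope classical_set_scope.
Local Open Scope quotient_scope.
Local Open Scope ring_scope.

Section Ideals.
Context {A : comNzRingType}.
Implicit Types (I J P m S : set A).

Definition is_ideal I : Prop :=
  I 0 /\ forall a u v, I u -> I v -> I (a * u + v).

Definition ideal_gen S : set A :=
  [set x | exists n (c g : 'I_n -> A),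
     (forall i, S (g i)) /\ x = \sum_(i < n) c i * g i].

Definition ideal_mul I J : set A :=
  ideal_gen [set z | exists x y, [/\ I x, J y & z = x * y]].

Fixpoint ideal_pow I (n : nat) : set A :=
  if n is n'.+1 then ideal_mul I (ideal_pow I n') else setT.

Definition is_prime_ideal P : Prop :=
  [/\ is_ideal P, ~ P 1 & forall x y, P (x * y) -> P x \/ P y].

Definition is_maximal_ideal m : Prop :=
  [/\ is_ideal m, ~ m 1 & forall I, is_ideal I -> ~ I 1 -> m `<=` I -> I = m].

(* c 0 `<` c 1 `<` ... `<` c n; the values of c beyond n are irrelevant *)
Definition prime_chain (n : nat) (c : nat -> set A) : Prop :=
  (forall i, (i <= n)%N -> is_prime_ideal (c i)) /\
  (forall i, (i < n)%N -> c i `<` c i.+1).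

Definition height P (h : nat) : Prop :=
  (exists c, prime_chain h c /\ c h = P) /\
  (forall n c, prime_chain n c -> c n = P -> (n <= h)%N).

Definition is_unit (x : A) : Prop := exists y, y * x = 1.

Definition associate (x y : A) : Prop := exists u, is_unit u /\ y = u * x.

Definition is_irreducible (p : A) : Prop :=
  [/\ p <> 0, ~ is_unit p
    & forall a b, p = a * b -> is_unit a \/ is_unit b].

End Ideals.

Definition krull_dim (A : comNzRingType) (d : nat) : Prop :=
  (exists c : nat -> set A, prime_chain d c) /\
  (forall n (c : nat -> set A), prime_chain n c -> (n <= d)%N).

Definition noetherian (A : comNzRingType) : Prop :=
  forall I : set A, is_ideal I -> exists s : seq A, I = ideal_gen [set` s].

Definition is_local (A : comNzRingType) (m : set A) : Prop :=
  is_maximal_ideal m /\ forall n : set A, is_maximal_ideal n -> n = m.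

Definition is_domain (D : comPzRingType) : Prop :=
  (1 : D) <> 0 /\ GRing.integral_domain_axiom D.

Definition is_UFD (A : comNzRingType) : Prop :=
  [/\ is_domain A,
      forall x : A, x <> 0 -> ~ is_unit x ->
        exists s : seq A,
          (forall p, p \in s -> is_irreducible p) /\ x = \prod_(p <- s) p
    & forall s t : seq A,
        (forall p, p \in s -> is_irreducible p) ->
        (forall p, p \in t -> is_irreducible p) ->
        \prod_(p <- s) p = \prod_(p <- t) p ->
        exists t' : seq A,
          [/\ perm_eq t t', size s = size t'
            & forall i, (i < size s)%N -> associate s`_i t'`_i]].

(* The A-module A/(x), as a quotient of the additive group of A. *)
Section PrincipalQuotient.
Variables (A : comNzRingType) (x : A).

Definition principal : {pred A} := fun y => `[< exists c, y = c * x >].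

Fact principal_zmod_closed : zmod_closed principal.
Proof.
split; first by apply/asboolP; exists 0; rewrite mul0r.
move=> u v /asboolP[a ->] /asboolP[b ->].
by apply/asboolP; exists (a - b); rewrite mulrBl.
Qed.

HB.instance Definition _ :=
  GRing.isZmodClosed.Build A principal principal_zmod_closed.

Definition quot_mod := {ideal_quot principal}.

HB.instance Definition _ := GRing.Zmodule.on quot_mod.

Definition quot_scale (a : A) (u : quot_mod) : quot_mod :=
  \pi_({ideal_quot principal}) (a * repr u).

Lemma quot_scale_pi a y :
  quot_scale a (\pi_({ideal_quot principal}) y) = \pi_({ideal_quot principal}) (a * y).
Proof.
apply/eqP; rewrite /quot_scale -Quotient.idealrBE -mulrBr.
have /asboolP[c ->] : repr (\pi_({ideal_quot principal}) y) - y \in principal.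
  by rewrite Quotient.idealrBE reprK.
by apply/asboolP; exists (a * c); rewrite mulrA.
Qed.

Fact quot_scaleA a b v : quot_scale a (quot_scale b v) = quot_scale (a * b) v.
Proof. by rewrite -[v]reprK (quot_scale_pi b) !quot_scale_pi mulrA. Qed.

Fact quot_scale1 : left_id 1 quot_scale.
Proof. by move=> v; rewrite /quot_scale mul1r reprK. Qed.

Fact quot_scaleDr : right_distributive quot_scale +%R.
Proof.
move=> a u v; rewrite -[u]reprK -[v]reprK -[_ + _ in LHS]raddfD.
by rewrite !quot_scale_pi mulrDr raddfD.
Qed.

Fact quot_scaleDl v : {morph quot_scale^~ v : a b / a + b}.
Proof. by move=> a b; rewrite /quot_scale mulrDl raddfD. Qed.

HB.instance Definition _ := GRing.Zmodule_isLmodule.Build A quot_mod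
  quot_scaleA quot_scale1 quot_scaleDr quot_scaleDl.

End PrincipalQuotient.

(* Ass_A(M), and its members of height h *)
Definition Ass (A : comNzRingType) (M : lmodType A) : set (set A) :=
  [set P | is_prime_ideal P /\ exists v : M, P = [set a | a *: v = 0]].

Definition Ass_height (A : comNzRingType) (h : nat) (M : lmodType A) :
    set (set A) :=
  [set P | Ass M P /\ height P h].

(* The ring G_m(A) = \bigoplus_n m^n / m^(n+1) : an element is represented by
   a polynomial whose coefficient of degree n lies in m^n, and two polynomials
   are identified when, for all n, their coefficients of degree n agree modulo
   m^(n+1). The construction makes sense for an arbitrary subset m of A. *)
Section AssociatedGraded.
Variables (A : comNzRingType) (m : set A).

Lemma ideal_gen_ideal (S : set A) : is_ideal (ideal_gen S).
Proof.
split.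
  exists 0%N, (fun=> 0), (fun=> 0); split; first by case.
  by rewrite big_ord0.
move=> a _ _ [n [c [g [Sg ->]]]] [n' [c' [g' [Sg' ->]]]].
exists (n + n')%N,
  (fun i : 'I_(n + n') => match fintype.split i with inl j => a * c j | inr j => c' j end),
  (fun i : 'I_(n + n') => match fintype.split i with inl j => g j | inr j => g' j end).
split; first by move=> i; case: (fintype.split i).
rewrite big_split_ord /= mulr_sumr; congr (_ + _); apply: eq_bigr => i _.
  by rewrite -[lshift _ _]/(unsplit (inl i)) unsplitK mulrA.
by rewrite -[rshift _ _]/(unsplit (inr i)) unsplitK.
Qed.

Lemma ideal_sum (I : set A) n (F : 'I_n -> A) :
  is_ideal I -> (forall i, I (F i)) -> I (\sum_(i < n) F i).
Proof.
move=> [I0 Il] IF; apply: big_ind => // u v Iu Iv.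
by rewrite -[u]mul1r; apply: Il.
Qed.

Lemma ideal_mull (I : set A) a u : is_ideal I -> I u -> I (a * u).
Proof. by move=> [I0 Il] Iu; rewrite -[_ * _]addr0; apply: Il. Qed.

Lemma ideal_pow_ideal n : is_ideal (ideal_pow m n).
Proof. by case: n => [//|n]; exact: ideal_gen_ideal. Qed.

Lemma ideal_powM i j x y :
  ideal_pow m i x -> ideal_pow m j y -> ideal_pow m (i + j) (x * y).
Proof.
elim: i x => [|i IHi] x.
  by move=> _ my; apply: ideal_mull my; exact: ideal_pow_ideal.
move=> [n [c [g [Sg ->]]]] my; rewrite mulr_suml addSn.
apply: ideal_sum => [|k]; first exact: ideal_pow_ideal.
rewrite -mulrA; apply: ideal_mull; first exact: ideal_pow_ideal.
have [a [b [ma mb ->]]] := Sg k; rewrite -mulrA.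
exists 1%N, (fun=> 1), (fun=> a * (b * y)); split.
  by move=> _; exists a, (b * y); split=> //; exact: IHi.
by rewrite big_ord1 mul1r.
Qed.

Definition rees : {pred {poly A}} :=
  fun p => `[< forall n, ideal_pow m n p`_n >].

Fact rees_subring_closed : subring_closed rees.
Proof.
split=> [|p q /asboolP mp /asboolP mq|p q /asboolP mp /asboolP mq].
- apply/asboolP => -[//|n]; rewrite coef1 /=.
  by case: (ideal_pow_ideal n.+1).
- apply/asboolP => n; rewrite coefB addrC -mulN1r.
  by case: (ideal_pow_ideal n) => _; apply.
- apply/asboolP => n; rewrite coefM; apply: ideal_sum => [|i].
    exact: ideal_pow_ideal.
  by rewrite -{1}(subnKC (leq_ord i)); exact: ideal_powM.
Qed.

HB.instance Definition _ :=
  GRing.isSubringClosed.Build {poly A} rees rees_subring_closed.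

Record rees_ring := ReesRing { rees_poly :> {poly A}; _ : rees_poly \in rees }.

HB.instance Definition _ := [isSub for rees_poly].
HB.instance Definition _ := [Choice of rees_ring by <:].
HB.instance Definition _ :=
  [SubChoice_isSubComNzRing of rees_ring by <:].

Definition rees_ideal : {pred rees_ring} :=
  fun p => `[< forall n, ideal_pow m n.+1 (rees_poly p)`_n >].

Fact rees_ideal_zmod_closed : zmod_closed rees_ideal.
Proof.
split=> [|p q /asboolP mp /asboolP mq].
  apply/asboolP => n; rewrite [rees_poly 0](raddf0 (val : rees_ring -> _)).
  by rewrite coef0; case: (ideal_pow_ideal n.+1).
apply/asboolP => n; rewrite [rees_poly _](raddfB (val : rees_ring -> _)) /=.
rewrite coefB addrC -mulN1r.
by case: (ideal_pow_ideal n.+1) => _; apply.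
Qed.

Fact rees_idealM p q : q \in rees_ideal -> p * q \in rees_ideal.
Proof.
move=> /asboolP mq; apply/asboolP => n.
rewrite [rees_poly _](rmorphM (val : rees_ring -> _)) coefM.
apply: ideal_sum => [|i]; first exact: (ideal_pow_ideal n.+1).
rewrite -{1}(subnKC (leq_ord i)) -addnS; apply: ideal_powM => //.
by have /asboolP := valP p.
Qed.

HB.instance Definition _ :=
  GRing.isZmodClosed.Build rees_ring rees_ideal rees_ideal_zmod_closed.

Definition assoc_graded := {ideal_quot rees_ideal}.

HB.instance Definition _ := GRing.Zmodule.on assoc_graded.

Local Notation pi := (\pi_({ideal_quot rees_ideal})).

Definition assoc_graded_one : assoc_graded := pi 1.

Definition assoc_graded_mul (u v : assoc_graded) : assoc_graded :=
  pi (repr u * repr v).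

Lemma assoc_graded_mul_pi p q : assoc_graded_mul (pi p) (pi q) = pi (p * q).
Proof.
apply/eqP; rewrite /assoc_graded_mul -Quotient.idealrBE.
have repr_pi r : repr (pi r) - r \in rees_ideal.
  by rewrite Quotient.idealrBE reprK.
rewrite -(subrKA (p * repr (pi q))) -mulrBl -mulrBr [X in X + _]mulrC.
by apply: rpredD; apply: rees_idealM; exact: repr_pi.
Qed.

Fact assoc_graded_mulA : associative assoc_graded_mul.
Proof.
move=> u v w; rewrite -[u]reprK -[v]reprK -[w]reprK.
rewrite (assoc_graded_mul_pi (repr v)) (assoc_graded_mul_pi (repr u) (repr v)).
by rewrite !assoc_graded_mul_pi mulrA.
Qed.

Fact assoc_graded_mulC : commutative assoc_graded_mul.
Proof. by move=> u v; rewrite /assoc_graded_mul mulrC. Qed.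

Fact assoc_graded_mul1 : left_id assoc_graded_one assoc_graded_mul.
Proof.
by move=> u; rewrite -[u]reprK assoc_graded_mul_pi mul1r.
Qed.

Fact assoc_graded_mulDl : left_distributive assoc_graded_mul +%R.
Proof.
move=> u v w; rewrite -[u]reprK -[v]reprK -[w]reprK -[_ + _ in LHS]raddfD.
by rewrite !assoc_graded_mul_pi mulrDl raddfD.
Qed.

HB.instance Definition _ := GRing.Zmodule_isComPzRing.Build assoc_graded
  assoc_graded_mulA assoc_graded_mulC assoc_graded_mul1 assoc_graded_mulDl.

End AssociatedGraded.

Section StandardGraded.
Variables (k : fieldType) (A : comAlgType k) (Ag : nat -> set A).

(* A is the internal direct sum of the k-subspaces Ag n, with Ag 0 = k, and
   is generated as a k-algebra by finitely many elements of Ag 1. *)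
Definition standard_graded : Prop :=
  [/\ forall n, Ag n 0 /\
        (forall (a : k) x y, Ag n x -> Ag n y -> Ag n (a *: x + y)),
      (forall x : A, exists n (f : nat -> A),
        (forall i, Ag i (f i)) /\ x = \sum_(i < n) f i) /\
      (forall n (f : nat -> A), (forall i, Ag i (f i)) ->
        \sum_(i < n) f i = 0 -> forall i, (i < n)%N -> f i = 0),
      Ag 0%N = [set x | exists a : k, x = a%:A],
      forall i j x y, Ag i x -> Ag j y -> Ag (i + j)%N (x * y)
    & exists s : seq A, (forall x, x \in s -> Ag 1%N x) /\
        forall B : {pred A}, GRing.subalg_closed B -> {subset s <= B} ->
          forall x, x \in B].

Definition homogeneous : set A := [set x | exists n, Ag n x].

Definition irrelevant_ideal : set A :=
  [set x | exists n (f : nat -> A),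
     (forall i, Ag i.+1 (f i)) /\ x = \sum_(i < n) f i].

End StandardGraded.

(* adm is the set of admissible elements: setT in the local case, the
   homogeneous elements in the graded case. *)
Section Alpha.
Variables (R : realType) (A : comNzRingType) (m adm : set A).

Definition num_ass1 (x : A) : \bar R := counting (Ass_height 1 (quot_mod x)).

Definition alpha_at (s : nat) : \bar R :=
  ereal_sup [set num_ass1 x | x in
    [set x | [/\ adm x, GRing.lreg x
               & (ideal_pow m s `\` ideal_pow m s.+1) x]]].

Definition alpha : \bar R :=
  limn_esup (fun s => (alpha_at s * (s%:R^-1)%:E)%E).

End Alpha.

(* Main.v *)
(* Upper bound: a height-one prime associated to A/(x) contains an irreducible
   factor of x, hence is generated by it; every irreducible factor of x lies in
   m, so x outside m^(s+1) has at most s of them.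
   Lower bound: a product of s pairwise non-associate elements of m \ m^2 lies
   in m^s \ m^(s+1), because G_m(A) is a domain, and each factor is irreducible,
   hence generates an associated prime of height one. Such elements are
   a + b^(n+2) in the local case, with a in m \ m^2 and b in m \ (a), and
   a + e b in the graded case, with a, b independent of degree one and e
   ranging over the infinite field k. *)
Require Import Defs.
From HB Require Import structures.
From mathcomp Require Import all_boot all_order all_algebra.
From mathcomp Require Import all_classical all_reals all_analysis.

Local Open Scope classical_set_scope.
Local Open Scope ring_scope.

Import Order.TTheory GRing.Theory Num.Theory.
Set Implicit Arguments.
Unset Strict Implicit.
Unset Printing Implicit Defensive.

(** * Ideals, divisibility and associates in a domain *)

Section Domain.
Context {A : comNzRingType}.
Implicit Types (x y z p q : A) (I P m : set A) (s : seq A).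

Lemma domain_mul0 x y : is_domain A -> x * y = 0 -> x = 0 \/ y = 0.
Proof. by move=> [_ dA] /dA /orP[]/eqP; [left|right]. Qed.

Lemma domain_mulIf z x y : is_domain A -> z <> 0 -> x * z = y * z -> x = y.
Proof.
move=> dA z0 /eqP; rewrite -subr_eq0 -mulrBl => /eqP /(domain_mul0 dA)[|//].
by move=> /eqP; rewrite subr_eq0 => /eqP.
Qed.

Lemma is_unitMl x y : is_unit (x * y) -> is_unit x.
Proof. by move=> [u uxy]; exists (u * y); rewrite mulrAC -mulrA. Qed.

Lemma is_unitMr x y : is_unit (x * y) -> is_unit y.
Proof. by rewrite mulrC; exact: is_unitMl. Qed.

Lemma ideal_mulr I x y : is_ideal I -> I x -> I (x * y).
Proof. by rewrite mulrC; exact: ideal_mull. Qed.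

Lemma idealD I x y : is_ideal I -> I x -> I y -> I (x + y).
Proof. by move=> [_ iI] Ix Iy; rewrite -[x]mul1r; exact: iI. Qed.

Lemma idealB I x y : is_ideal I -> I x -> I y -> I (x - y).
Proof. by move=> [_ iI] Ix Iy; rewrite addrC -mulN1r; exact: iI. Qed.

Lemma ideal_unit I x : is_ideal I -> is_unit x -> I x -> I 1.
Proof. by move=> iI [y <-] Ix; exact: ideal_mull. Qed.

Lemma ideal_prod I s x : is_ideal I -> x \in s -> I x -> I (\prod_(p <- s) p).
Proof.
move=> iI; elim: s => [//|y s IHs]; rewrite inE big_cons => /orP[/eqP <-|xs] Ix.
  exact: ideal_mulr.
by apply: ideal_mull => //; exact: IHs.
Qed.

Lemma prime_ideal_prod P s :
  is_prime_ideal P -> P (\prod_(p <- s) p) -> exists2 p, p \in s & P p.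
Proof.
move=> [iP P1 PM]; elim: s => [|p s IHs]; first by rewrite big_nil.
rewrite big_cons => /PM[Pp|/IHs[q qs Pq]].
  by exists p => //; rewrite mem_head.
by exists q => //; rewrite in_cons qs orbT.
Qed.

Lemma prime_ideal0 : is_domain A -> is_prime_ideal [set 0 : A].
Proof.
move=> dA; split.
- by split=> // a _ _ -> ->; rewrite mulr0 addr0.
- by case: dA.
- by move=> x y /(domain_mul0 dA).
Qed.

Definition multiples p : set A := [set y | exists c, y = c * p].

Lemma multiples_ideal p : is_ideal (multiples p).
Proof.
split; first by exists 0; rewrite mul0r.
by move=> a _ _ [c ->] [d ->]; exists (a * c + d); rewrite mulrDl mulrA.
Qed.

Lemma multiples_id p : multiples p p.
Proof. by exists 1; rewrite mul1r. Qed.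

Lemma multiples_sub I p : is_ideal I -> I p -> multiples p `<=` I.
Proof. by move=> iI Ip _ [c ->]; exact: ideal_mull. Qed.

Lemma multiples_associate p q :
  is_domain A -> multiples p = multiples q -> associate p q.
Proof.
move=> dA epq; have [c qE] : multiples p q by rewrite epq; exact: multiples_id.
have [d pE] : multiples q p by rewrite -epq; exact: multiples_id.
have [p0|/eqP p0] := eqVneq p 0.
  by exists 1; split; [exists 1; rewrite mulr1|rewrite qE p0 mulr0 mul1r].
exists c; split=> //; exists d; apply: (domain_mulIf dA p0).
by rewrite mul1r -mulrA -qE.
Qed.

Lemma associate_multiples p q : associate p q -> multiples q p.
Proof. by move=> [u [[v vu] ->]]; exists v; rewrite mulrA vu mul1r. Qed.

Lemma irreducible_unitM u p :
  is_unit u -> is_irreducible p -> is_irreducible (u * p).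
Proof.
move=> [v vu] [p0 pnu pirr].
have vup : v * (u * p) = p by rewrite mulrA vu mul1r.
split; first by move=> up0; apply: p0; rewrite -vup up0 mulr0.
  by move=> /is_unitMr.
move=> a b upE; have /pirr[/is_unitMr|] : p = (v * a) * b.
- by rewrite -mulrA -upE.
- by left.
- by right.
Qed.

End Domain.

(** * Height-one primes and associated primes of A/(x) in a UFD *)

Section UFD.
Context {A : comNzRingType} (ufdA : is_UFD A).
Implicit Types (x y p q : A) (P m : set A) (s : seq A).

Lemma UFD_domain : is_domain A. Proof. by case: ufdA. Qed.

(** If ab = cp, uniqueness of factorization places an associate of p among the irreducible factors
    of a or of b. *)
Lemma irreducible_prime p : is_irreducible p -> is_prime_ideal (multiples p).
Proof.
have [dA fact uniq] := ufdA => pirr; have [p0 pnu _] := pirr.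
split; first exact: multiples_ideal.
  by move=> [c c1]; apply: pnu; exists c.
move=> a b [c abE].
have [a0|/eqP a0] := eqVneq a 0.
  by left; rewrite a0; case: (multiples_ideal p).
have [b0|/eqP b0] := eqVneq b 0.
  by right; rewrite b0; case: (multiples_ideal p).
have [[u ua]|anu] := pselect (is_unit a).
  by right; exists (u * c); rewrite -mulrA -abE mulrA ua mul1r.
have [[u ub]|bnu] := pselect (is_unit b).
  by left; exists (u * c); rewrite -mulrA -abE mulrCA ub mulr1.
have c0 : c <> 0.
  by move=> c0; move: abE; rewrite c0 mul0r => /(domain_mul0 dA)[].
have [sa [sairr aE]] := fact _ a0 anu; have [sb [sbirr bE]] := fact _ b0 bnu.
(* A factorization of cp headed by a multiple q of p: q is cp itself when c is a unit, and p
   otherwise. *)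
have [q [s [sirr sE pq]]] : exists q s,
    [/\ forall r, r \in q :: s -> is_irreducible r,
        c * p = \prod_(r <- q :: s) r & multiples p q].
  have [cu|cnu] := pselect (is_unit c).
    exists (c * p), [::]; split; last by exists c.
      by move=> r; rewrite inE => /eqP ->; exact: irreducible_unitM.
    by rewrite big_seq1.
  have [s [sirr cE]] := fact _ c0 cnu; exists p, s.
  split; last exact: multiples_id; last by rewrite big_cons -cE mulrC.
  by move=> r; rewrite inE => /orP[/eqP ->|/sirr].
have tirr r : r \in sa ++ sb -> is_irreducible r.
  by rewrite mem_cat => /orP[/sairr|/sbirr].
have /(uniq _ _ sirr tirr) : \prod_(r <- q :: s) r = \prod_(r <- sa ++ sb) r.
  by rewrite -sE -abE big_cat -aE -bE.
move=> [[|r t'] [ptt' //= _ /(_ 0 isT)/= [u [_ rE]]]].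
have pr : multiples p r.
  by rewrite rE; apply: ideal_mull => //; exact: multiples_ideal.
have : r \in sa ++ sb by rewrite (perm_mem ptt') mem_head.
rewrite mem_cat aE bE => /orP[] rs; [left|right];
  by apply: ideal_prod rs pr; exact: multiples_ideal.
Qed.

(** Strictness over [Q] supplies a nonzero element of [P]; it is a nonunit, and primality picks out
    one of its irreducible factors. *)
Lemma prime_ideal_irreducible Q P :
  is_ideal Q -> is_prime_ideal P -> Q `<` P ->
  exists2 p, is_irreducible p & P p.
Proof.
move=> [Q0 _] primeP [_ PQ]; have [iP P1 _] := primeP; have [_ fact _] := ufdA.
have [x Px x0] : exists2 x, P x & x <> 0.
  apply: contrapT => noP; apply: PQ => x Px.
  by have [->//|/eqP x0] := eqVneq x 0; case: noP; exists x.
have [s [sirr xE]] := fact _ x0 (fun xu => P1 (ideal_unit iP xu Px)).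
have [p ps Pp] : exists2 p, p \in s & P p.
  by apply: prime_ideal_prod; rewrite -?xE.
by exists p => //; exact: sirr.
Qed.

(** [P] contains an irreducible q = cp; as p is not a unit, c is one, so p lies in [P]. Hence no
    nonzero prime lies strictly inside (p). *)
Lemma prime_sub_multiples Q P p :
  is_ideal Q -> is_prime_ideal P -> Q `<` P -> ~ is_unit p ->
  P `<=` multiples p -> multiples p `<=` P.
Proof.
move=> iQ primeP QP pnu Pp; have [iP _ _] := primeP.
have [q qirr Pq] := prime_ideal_irreducible iQ primeP QP.
have [c qE] := Pp _ Pq; have [_ _ /(_ _ _ qE)[[d dc]|//]] := qirr.
apply: multiples_sub => //.
by rewrite -[p]mul1r -dc -mulrA -qE; exact: ideal_mull.
Qed.

Lemma height_irreducible p : is_irreducible p -> height (multiples p) 1.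
Proof.
move=> pirr; have [p0 pnu _] := pirr; have pp := irreducible_prime pirr.
split.
  exists (fun i => if i is 0 then [set 0] else multiples p).
  split=> //; split.
    by move=> [|[|//]] _ //; exact: (prime_ideal0 UFD_domain).
  move=> [|//] _; split.
    by move=> _ ->; case: (multiples_ideal p).
  by move=> /(_ p (multiples_id p)).
(* A chain of length at least 2 ending at (p) has a nonzero prime [c n.+1] strictly inside (p). *)
move=> [//|[//|n]] c [cp cs] cE.
have [] := cs n.+1 (leqnn _); rewrite cE => sub [].
apply: prime_sub_multiples (cs n (leqnSn _)) pnu sub; last exact: cp.
by have [] := cp n (leq_trans (leqnSn _) (leqnSn _)).
Qed.

(** If (p) differed from [P], then 0 < (p) < [P] would be a chain of length 2. *)
Lemma height1_multiples P p :
  height P 1 -> is_irreducible p -> P p -> P = multiples p.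
Proof.
move=> [[c [[cp _] cE]] hP] pirr Pp.
have [iP P1 _] : is_prime_ideal P by rewrite -cE; exact: cp.
have sub := multiples_sub iP Pp.
apply: contrapT => Pnp; have [p0 pnu _] := pirr.
suff /hP : prime_chain 2 (fun i => match i with
  | 0 => [set 0] | 1 => multiples p | _ => P end) by move=> /(_ erefl).
split.
  move=> [|[|[|//]]] _ //=.
  - exact: (prime_ideal0 UFD_domain).
  - exact: irreducible_prime.
  - by rewrite -cE; exact: cp.
move=> [|[|//]] _ /=; split.
- by move=> _ ->; case: (multiples_ideal p).
- by move=> /(_ p (multiples_id p)).
- exact: sub.
- by move=> Psub; apply: Pnp; rewrite eqEsubset.
Qed.

Lemma quot_pi_eq0 x y :
  \pi_({ideal_quot principal x})%qT y = 0 :> quot_mod x <-> multiples x y.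
Proof.
have -> : 0 = \pi_({ideal_quot principal x})%qT 0 :> quot_mod x.
  by rewrite raddf0.
split=> [/eqP|yx]; last apply/eqP; rewrite -Quotient.idealrBE subr0.
  by move=> /asboolP.
exact/asboolP.
Qed.

(** The element x annihilates A/(x). *)
Lemma Ass_principal_sub x P : Ass (quot_mod x) P -> P x.
Proof.
move=> [_ [v ->]] /=; rewrite -[v]reprK [LHS]quot_scale_pi.
by apply/quot_pi_eq0; exists (repr v); rewrite mulrC.
Qed.

(** Asking only that the product lie in (x) lets the empty list serve when x is a unit. *)
Lemma Ass_height1_principal_sub x s : (forall p, p \in s -> is_irreducible p) ->
  multiples x (\prod_(p <- s) p) ->
  Ass_height 1 (quot_mod x) `<=` multiples @` [set` s].
Proof.
move=> sirr xs P [assP hP]; have Px := Ass_principal_sub assP.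
have [primeP _] := assP; have [iP _ _] := primeP.
have [p ps Pp] := prime_ideal_prod primeP (multiples_sub iP Px xs).
by exists p => //; rewrite -(height1_multiples hP (sirr _ ps)).
Qed.

(** By cancelling y, the annihilator of the class of y in A/(py) is (p). *)
Lemma Ass_height1_irreducible p y : is_irreducible p -> y <> 0 ->
  Ass_height 1 (quot_mod (p * y)) (multiples p).
Proof.
move=> pirr y0; split; last exact: height_irreducible.
split; first exact: irreducible_prime.
exists (\pi_({ideal_quot principal (p * y)}) y)%qT.
rewrite eqEsubset; split=> a /=; rewrite [_ *: _]quot_scale_pi.
  by move=> [c ->]; apply/quot_pi_eq0; exists c; rewrite mulrA.
move=> /quot_pi_eq0[c]; rewrite mulrA => /(domain_mulIf UFD_domain y0) ->.
by exists c.
Qed.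

End UFD.

(** * Powers of m and initial forms in the associated graded ring *)

Section IdealPowers.
Context {A : comNzRingType}.
Implicit Types (x y : A) (m : set A) (s : seq A).

Lemma ideal_pow1 m x : m x -> ideal_pow m 1 x.
Proof.
move=> mx; exists 1, (fun=> 1), (fun=> x); split.
  by move=> _; exists x, 1; split=> //; rewrite mulr1.
by rewrite big_ord1 mul1r.
Qed.

Lemma ideal_pow_prod m s :
  (forall x, x \in s -> m x) -> ideal_pow m (size s) (\prod_(x <- s) x).
Proof.
elim: s => [//|x s IHs] ms; rewrite big_cons.
rewrite -[size _]/(1 + size s)%N; apply: ideal_powM.
  by apply/ideal_pow1/ms/mem_head.
by apply: IHs => y ys; apply: ms; rewrite inE ys orbT.
Qed.

Lemma ideal_pow_le m i j x : (i <= j)%N -> ideal_pow m j x -> ideal_pow m i x.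
Proof.
move=> /subnK <-; elim: (j - i)%N x => [//|n IHn] x /= [k [c [g [gP ->]]]].
apply: ideal_sum => [|l]; first exact: ideal_pow_ideal.
apply: ideal_mull; first exact: ideal_pow_ideal.
have [u [v [_ mv ->]]] := gP l.
by apply: ideal_mull; [exact: ideal_pow_ideal|exact: IHn].
Qed.

Definition graded_class m (p : rees_ring m) : assoc_graded m :=
  \pi_({ideal_quot @rees_ideal A m})%qT p.

Lemma graded_class_eq0 m (p : rees_ring m) :
  graded_class p = 0 <->
  p \in @rees_ideal A m.
Proof.
have -> : 0 = graded_class (0 : rees_ring m).
  by rewrite /graded_class raddf0.
by split=> [/eqP|p0]; last apply/eqP; rewrite -Quotient.idealrBE subr0.
Qed.

Lemma rees_monomial m i x : ideal_pow m i x -> x *: 'X^i \in rees m.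
Proof.
move=> mx; apply/asboolP => n; rewrite coefZ coefXn.
have [->|_] := eqVneq n i; first by rewrite mulr1.
by rewrite mulr0; case: (ideal_pow_ideal m n).
Qed.

(** Its class in G_m(A) is the residue of x in m^i/m^(i+1), placed in degree i. *)
Definition initial_form m i x (mx : ideal_pow m i x) : rees_ring m :=
  ReesRing (rees_monomial mx).

Lemma initial_form_eq0 m i x (mx : ideal_pow m i x) :
  graded_class (initial_form mx) = 0 <->
  ideal_pow m i.+1 x.
Proof.
rewrite graded_class_eq0; split=> [/asboolP/(_ i)|mx1].
  by rewrite /= coefZ coefXn eqxx mulr1.
apply/asboolP => n; rewrite /= coefZ coefXn.
have [->|_] := eqVneq n i; first by rewrite mulr1.
by rewrite mulr0; case: (ideal_pow_ideal m n.+1).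
Qed.

(** The product of the classes of x and y in degrees i and j is the class of xy in degree i + j, and
    G_m(A) has no zero divisors. *)
Lemma ideal_pow_mulN m i j x y : is_domain (assoc_graded m) ->
  (ideal_pow m i `\` ideal_pow m i.+1) x ->
  (ideal_pow m j `\` ideal_pow m j.+1) y ->
  (ideal_pow m (i + j) `\` ideal_pow m (i + j).+1) (x * y).
Proof.
move=> [_ dG] [mx nx] [my ny]; have mxy := ideal_powM mx my; split=> //.
move=> /(initial_form_eq0 mxy) xy0.
have : graded_class (initial_form mx) * graded_class (initial_form my) = 0.
  rewrite [LHS]assoc_graded_mul_pi -xy0; congr graded_class.
  apply: val_inj; rewrite rmorphM /=.
  by rewrite -scalerAl -scalerAr scalerA -exprD.
by move=> /dG/orP[]/eqP/initial_form_eq0.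
Qed.

(** A factorization into two nonunits would have both factors in m. The condition concerns divisors
    of x alone because a nonunit of a graded algebra need not lie in m. *)
Lemma irreducible_ideal_pow2 m x :
  (forall a, multiples a x -> ~ is_unit a -> m a) ->
  ~ is_unit x -> ~ ideal_pow m 2 x -> is_irreducible x.
Proof.
move=> mdvd xnu nx; split=> // [x0|a b xE].
  by apply: nx; rewrite x0; case: (ideal_pow_ideal m 2).
apply: contrapT => /not_orP[au bu]; apply: nx; rewrite xE -[2%N]/(1 + 1)%N.
by apply: ideal_powM; apply: ideal_pow1; apply: mdvd => //;
  [exists b; rewrite mulrC|exists a].
Qed.

(** Otherwise the class of 1 in G_m(A) would vanish. This keeps units out of m in the local and
    graded cases alike. *)
Lemma ideal_pow1_neq1 m : is_domain (assoc_graded m) -> ~ ideal_pow m 1 1.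
Proof.
move=> [G1 _] m1; apply: G1; apply/graded_class_eq0/asboolP => n.
rewrite coef1; case: n => [//|n]; by case: (ideal_pow_ideal m n.+2).
Qed.

End IdealPowers.

(** * Counting associated primes, and the value of alpha *)

Section Alpha.
Context {R : realType} {A : comNzRingType} (ufdA : is_UFD A).
Implicit Types (x y p q : A) (m adm : set A) (s : seq A).

Lemma num_ass1_le x s : (forall p, p \in s -> is_irreducible p) ->
  multiples x (\prod_(p <- s) p) -> (num_ass1 R x <= (size s)%:R%:E)%E.
Proof.
move=> sirr /(Ass_height1_principal_sub ufdA sirr) sub.
have fin : finite_set (multiples @` [set` s]) by exact: finite_image.
(* [counting] is infinite on infinite sets, so finiteness has to precede the bound. *)
rewrite /num_ass1 /counting asboolT; last exact: sub_finite_set sub fin.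
rewrite lee_fin ler_nat; apply: geq_card_fset_set.
apply: card_le_trans (subset_card_le sub) _.
apply: card_le_trans (card_image_le _ _) _.
apply: (@card_le_trans _ _ _ ((fun i => s`_i) @` `I_(size s))).
  by apply: subset_card_le => p /(nthP 0)[i si <-]; exists i.
exact: card_image_le.
Qed.

(** Each (y i) with i < n is the annihilator of the class of the product of the other factors, and
    equal principal ideals would have associate generators. *)
Lemma num_ass1_ge n (y : nat -> A) : (forall i, is_irreducible (y i)) ->
  (forall i j, associate (y i) (y j) -> i = j) ->
  (n%:R%:E <= num_ass1 R (\prod_(i < n) y i))%E.
Proof.
move=> yirr yinj; rewrite /num_ass1 /counting.
case: asboolP => [fin|_]; last by rewrite leey.
rewrite lee_fin ler_nat; apply: leq_card_fset_set => //.
apply: (@card_le_trans _ _ _ ((multiples \o y) @` `I_n)); last first.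
  apply: subset_card_le.
  move=> _ [i /= ltin <-]; rewrite (bigD1 (Ordinal ltin)) //=.
  apply: (Ass_height1_irreducible ufdA (yirr i)).
  elim/big_ind: _ => [|a b a0 b0|j _].
  - by have [] := UFD_domain ufdA.
  - by move=> /(domain_mul0 (UFD_domain ufdA))[].
  - by have [] := yirr j.
rewrite (card_le_eqr (inj_card_eq _)) ?card_lexx // => i j _ _.
move=> /(multiples_associate (UFD_domain ufdA)).
exact: yinj.
Qed.

(** Common core of the local and graded cases: the product of the first n terms of y attains the
    upper bound n, so [alpha_at] takes the value n at n. *)
Lemma alpha_eq1 m adm (y : nat -> A) :
  is_domain (assoc_graded m) ->
  adm 1 -> (forall a b, adm a -> adm b -> adm (a * b)) ->
  (forall x a, adm x -> x <> 0 -> multiples a x -> ~ is_unit a -> m a) ->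
  (forall i, [/\ adm (y i), m (y i) & ~ ideal_pow m 2 (y i)]) ->
  (forall i j, associate (y i) (y j) -> i = j) ->
  alpha R m adm = 1%:E.
Proof.
move=> dG adm1 admM admdvd yP yinj; have [_ fact _] := ufdA.
have y0 i : y i <> 0.
  by move=> yi0; have [_ _ []] := yP i; rewrite yi0; case: (ideal_pow_ideal m 2).
have yirr i : is_irreducible (y i).
  have [ay my ny] := yP i.
  apply: irreducible_ideal_pow2 ny => [a ya|yu]; first exact: admdvd ya.
  apply: (ideal_pow1_neq1 dG).
  by apply: (ideal_unit _ yu); [exact: ideal_pow_ideal|exact: ideal_pow1].
have yprod n : adm (\prod_(i < n) y i) /\
    (ideal_pow m n `\` ideal_pow m n.+1) (\prod_(i < n) y i).
  elim: n => [|n [IHa IHm]].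
    by rewrite big_ord0; split=> //; split=> //; exact: ideal_pow1_neq1.
  have [ay my ny] := yP n; rewrite big_ord_recr; split; first exact: admM.
  have := ideal_pow_mulN dG IHm (conj (ideal_pow1 my) ny); rewrite addn1; exact.
have alpha_atE n : alpha_at R m adm n = n%:R%:E.
  apply/eqP; rewrite eq_le; apply/andP; split.
    apply: ge_ereal_sup => _ [x [ax _ [mx nx]] <-].
    have x0 : x <> 0.
      by move=> x0; apply: nx; rewrite x0; case: (ideal_pow_ideal m n.+1).
    (* A unit has the empty factorization, and the bound is then 0. *)
    have [[u ux]|xnu] := pselect (is_unit x).
      apply: (le_trans (@num_ass1_le x [::] _ _)) => //.
        by exists u; rewrite big_nil.
      by rewrite lee_fin ler_nat.
    have [s [sirr xE]] := fact _ x0 xnu.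
    apply: (le_trans (@num_ass1_le x s sirr _)).
      by rewrite -xE; exact: multiples_id.
    (* With more than n irreducible factors, all in m, x would lie in m^(n+1). *)
    rewrite lee_fin ler_nat leqNgt; apply/negP => sn; apply: nx.
    apply: (ideal_pow_le sn); rewrite xE; apply: ideal_pow_prod => p ps.
    have [_ pnu _] := sirr _ ps; apply: (admdvd x) => //; rewrite xE.
    by apply: ideal_prod ps (multiples_id p); exact: multiples_ideal.
  apply: le_trans (num_ass1_ge n yirr yinj) _; apply: ereal_sup_ubound.
  have [ayn myn] := yprod n; exists (\prod_(i < n) y i) => //; split=> //.
  move=> a b /=; rewrite ![_ * b]mulrC ![_ * a]mulrC.
  apply: domain_mulIf (UFD_domain ufdA) _ => yn0; case: myn => _; apply.
  by rewrite yn0; case: (ideal_pow_ideal m n.+1).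
apply: (fun cvgu => (@cvg_limn_einf_sup _ _ _ cvgu).2).
(* The quotient is 1 only from index 1 on: at index 0 it is 0, since 0^-1 = 0. *)
apply: cvg_near_cst; exists 1 => // n /= n1.
by rewrite alpha_atE -EFinM mulfV // pnatr_eq0 -lt0n.
Qed.

End Alpha.

(** * Local rings *)

Section Local.
Context {A : comNzRingType}.
Implicit Types (x : A) (I S m : set A) (s : seq A).

Lemma maximal_ideal_ex I : is_ideal I -> ~ I 1 ->
  exists2 M, is_maximal_ideal M & I `<=` M.
Proof.
move=> iI I1.
(* The empty set is admitted because the empty chain has union set0. *)
pose P J := J = set0 \/ [/\ is_ideal J, ~ J 1 & I `<=` J].
have [|M [[M0|[iM M1 IM]] maxM]] := @Zorn_bigcup A P.
- move=> F FP tot; have [[X [FX X0]]|no] := pselect (exists X, F X /\ X !=set0).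
    right; have nz Y y : F Y -> Y y -> [/\ is_ideal Y, ~ Y 1 & I `<=` Y].
      by move=> /FP[->//|].
    have [x Xx] := X0; have [[XI0 _] _ IX] := nz _ _ FX Xx.
    split; [split=> [|a u v [Y FY Yu] [Z FZ Zv]]|move=> [Y FY Y1]|].
    + by exists X.
    + have [[_ iY] _ _] := nz _ _ FY Yu; have [[_ iZ] _ _] := nz _ _ FZ Zv.
      by have [YZ|ZY] := tot _ _ FY FZ;
        [exists Z => //; apply: iZ => //; exact: YZ|exists Y => //; apply: iY => //; exact: ZY].
    + by have [_ /(_ Y1)] := nz _ _ FY Y1.
    + by move=> y /IX Xy; exists X.
  left; rewrite -subset0 => x [X FX Xx].
  by case: no; exists X; split=> //; exists x.
(* The maximal set is not empty, since [I] would be strictly larger. *)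
- case: (maxM I); last by right; split.
  by rewrite M0; split=> // /(_ 0) []; case: iI.
- exists M => //; split=> // J iJ J1 MJ; apply: contrapT => JM.
  case: (maxM J); last by right; split=> //; exact: subset_trans MJ.
  by split=> // JsubM; apply: JM; rewrite eqEsubset.
Qed.

(** A nonunit generates a proper ideal, which lies in some maximal ideal, hence in m. *)
Lemma local_nonunit m x : is_local m -> ~ is_unit x -> m x.
Proof.
move=> [_ mE] xnu.
have [|M /mE <-] := maximal_ideal_ex (multiples_ideal x).
  by move=> [c c1]; apply: xnu; exists c.
by apply; exact: multiples_id.
Qed.

Lemma local_unit1B m x : is_local m -> m x -> is_unit (1 - x).
Proof.
move=> lm mx; apply: contrapT => /(local_nonunit lm) m1x.
have [[im m1 _] _] := lm; apply: m1.
by rewrite -(subrK x 1); exact: idealD.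
Qed.

Lemma local_sub m I : is_local m -> is_ideal I -> ~ I 1 -> I `<=` m.
Proof.
move=> lm iI I1 x Ix; apply: (local_nonunit lm) => xu.
by apply: I1; exact: ideal_unit xu Ix.
Qed.

Lemma ideal_gen_min I S : is_ideal I -> S `<=` I -> ideal_gen S `<=` I.
Proof.
move=> iI SI _ [n [c [g [gS ->]]]].
by apply: ideal_sum => // i; apply: ideal_mull => //; exact: SI.
Qed.

Lemma ideal_gen_sub S : S `<=` ideal_gen S.
Proof.
move=> x Sx; exists 1, (fun=> 1), (fun=> x); split=> //.
by rewrite big_ord1 mul1r.
Qed.

(** Induction on the list of generators: each in turn proves redundant, until none is left. *)
Lemma Nakayama_local m s : is_local m -> m = ideal_gen [set` s] ->
  m `<=` ideal_pow m 2 -> m = [set 0].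
Proof.
move=> lm + m2; have [[im _ _] _] := lm.
elim: s => [|x t IHt] mE.
  rewrite eqEsubset; split=> [y|_ ->]; last by case: im.
  rewrite mE => -[n [c [g [gS ->]]]] /=.
  by apply: big1 => i _; have := gS i.
apply: IHt; rewrite mE eqEsubset; split; apply: ideal_gen_min;
  try exact: ideal_gen_ideal; last first.
  by move=> y yt; apply: ideal_gen_sub; rewrite /= inE yt orbT.
(* m `<=` m^2 gives x = c x + w with c in m and w generated by t; as 1 - c is a
   unit, the generator x is redundant. *)
pose K (B : set A) :=
  [set z | exists c w, [/\ B c, ideal_gen [set` t] w & z = c * x + w]].
have iK B : is_ideal B -> is_ideal (K B).
  move=> iB; have it := ideal_gen_ideal [set` t]; split.
    by exists 0, 0; split; [case: iB|case: it|rewrite mul0r addr0].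
  move=> a _ _ [c [w [Bc tw ->]]] [c' [w' [Bc' tw' ->]]].
  exists (a * c + c'), (a * w + w'); split; first by case: iB => _; apply.
    by case: it => _; apply.
  by rewrite mulrDl mulrDr mulrA addrACA.
(* [K B] is the ideal Bx + (t). From m inside Ax + (t), multiplication by m gives m^2 inside mx +
   (t). *)
have mK : m `<=` K setT.
  rewrite mE; apply: ideal_gen_min; first exact: iK.
  have it := ideal_gen_ideal [set` t].
  move=> y /=; rewrite inE => /orP[/eqP ->|yt].
    by exists 1, 0; split=> //; [case: it|rewrite mul1r addr0].
  by exists 0, y; split=> //; [exact: ideal_gen_sub|rewrite mul0r add0r].
have m2K : ideal_pow m 2 `<=` K m.
  apply: ideal_gen_min; first exact: iK.
  move=> _ [u [v [mu m1v ->]]].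
  have /mK[c [w [_ tw ->]]] : m v.
    apply: ideal_gen_min m1v => // _ [p [q [mp _ ->]]]; exact: ideal_mulr.
  exists (u * c), (u * w); split; first exact: ideal_mulr.
    by apply: ideal_mull tw; exact: ideal_gen_ideal.
  by rewrite mulrDr mulrA.
have xt : ideal_gen [set` t] x.
  have /m2/m2K[c [w [mc tw xE]]] : m x.
    by rewrite mE; apply: ideal_gen_sub; rewrite /= mem_head.
  have [d dc] := local_unit1B lm mc.
  have wE : w = (1 - c) * x by rewrite mulrBl mul1r {1}xE addrAC subrr add0r.
  rewrite -[x]mul1r -dc -mulrA -wE.
  by apply: ideal_mull tw; exact: ideal_gen_ideal.
by move=> y; rewrite /= inE => /orP[/eqP ->//|yt]; exact: ideal_gen_sub.
Qed.

Lemma alpha_local (R : realType) m d : noetherian A -> is_local m -> is_UFD A ->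
  krull_dim A d -> (2 <= d)%N -> is_domain (assoc_graded m) ->
  alpha R m setT = 1%:E.
Proof.
move=> nA lm ufdA [[c [cp cs]] _] d2 dG.
have [[im m1 _] _] := lm; have dA := UFD_domain ufdA.
have d1 := ltnW d2; have [i0 _ _] := cp 0%N isT.
(* The chain [c 0] < [c 1] < [c 2] inside m will show that m is neither zero nor contained in
   (a). *)
have [i2 c21 _] := cp 2%N d2; have cm := local_sub lm i2 c21.
have mdvd x a (_ : True) (_ : multiples a x) : ~ is_unit a -> m a.
  exact: local_nonunit.
(* Were m inside m^2, Nakayama's lemma would make m zero. *)
have [a ma na] : exists2 a, m a & ~ ideal_pow m 2 a.
  apply: contrapT => noa; have [s mE] := nA m im.
  have m0 : m = [set 0].
    apply: (Nakayama_local lm mE) => a ma.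
    by apply: contrapT => na; apply: noa; exists a.
  have [_] := cs 0%N d1; apply => x c1x; have [sub _] := cs 1%N d2.
  have : m x by apply/cm/sub.
  by rewrite m0 => ->; case: i0.
have anu : ~ is_unit a by move=> au; exact: m1 (ideal_unit im au ma).
have airr : is_irreducible a.
  by apply: irreducible_ideal_pow2 na => // b _; exact: local_nonunit.
(* Were m inside (a), the nonzero prime [c 1] would lie in (a), hence contain (a) and with it
   [c 2]. *)
have [b mb nb] : exists2 b, m b & ~ multiples a b.
  apply: contrapT => nob.
  have ma_sub : m `<=` multiples a.
    by move=> b mb; apply: contrapT => nb; apply: nob; exists b.
  have [sub []] := cs 1%N d2.
  apply: subset_trans (subset_trans cm ma_sub) _.
  apply: (prime_sub_multiples ufdA i0 (cp 1%N d1) (cs 0%N d1) anu).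
  exact: subset_trans sub (subset_trans cm ma_sub).
(* The exponent is at least 2, so that [y n] agrees with a modulo m^2. *)
pose y n := a + b ^+ n.+2.
(* From y i = u y j follows (1 - u b^(j-i)) b^(i+2) = (u - 1) a, where the first factor is a unit;
   so the prime a divides b^(i+2), hence b, which was excluded. *)
have ndvd i j : (i < j)%N -> ~ multiples (y j) (y i).
  move=> ij [u yE].
  have [v vE] : is_unit (1 - u * b ^+ (j - i)).
    apply: (local_unit1B lm); apply: ideal_mull => //.
    by rewrite -(prednK (n := j - i)) ?subn_gt0 // exprS; exact: ideal_mulr.
  have [_ _ aM] := irreducible_prime ufdA airr.
  have : multiples a (b ^+ i.+2).
    exists (v * (u - 1)); rewrite -[LHS]mul1r -[in LHS]vE -!mulrA.
    congr (v * _).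
    rewrite !mulrBl !mul1r -mulrA -exprD !addnS subnK ?(ltnW ij) //.
    apply/eqP; move: yE; rewrite /y mulrDr => yE.
    by rewrite subr_eq addrAC -yE [a + _]addrC addrK.
  elim: i.+2 => [|n IHn].
    by rewrite expr0 => -[w w1]; apply: anu; exists w.
  by rewrite exprS => /aM[].
apply: (alpha_eq1 (y := y) ufdA dG) => // [x e _ _ _|n|i j yij].
- exact: local_nonunit.
- have pm n' : ideal_pow m 2 (b ^+ n'.+2).
    rewrite 2!exprS mulrA; apply: ideal_mulr; first exact: (ideal_pow_ideal m 2).
    by rewrite -[2%N]/(1 + 1)%N; apply: ideal_powM; exact: ideal_pow1.
  split=> //; first by apply: idealD => //; rewrite exprS; exact: ideal_mulr.
  move=> yn; apply: na; rewrite -[a](addrK (b ^+ n.+2)).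
  by apply: idealB => //; exact: (ideal_pow_ideal m 2).
- have [ij|ji|//] := ltngtP i j.
    by case: (ndvd _ _ ij); exact: associate_multiples.
  by case: (ndvd _ _ ji); have [u [_ ->]] := yij; exists u.
Qed.

End Local.

(** * Standard graded algebras *)

Section Graded.
Context {k : fieldType} {A : comAlgType k} (Ag : nat -> set A)
  (gA : standard_graded Ag).
Implicit Types (x y : A) (p q : {poly A}).
Local Notation m := (irrelevant_ideal Ag).

(* An element with homogeneous components x_0, x_1, ... is represented by the
   polynomial of coefficients x_i, of which it is the value at 1. *)
Definition graded_poly p : Prop := forall i, Ag i p`_i.

Lemma graded0 n : Ag n 0. Proof. by case: gA => /(_ n)[]. Qed.

Lemma gradedD n x y : Ag n x -> Ag n y -> Ag n (x + y).
Proof.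
case: gA => /(_ n)[_ Al] _ _ _ _ /(Al 1) /[apply].
by rewrite scale1r.
Qed.

Lemma gradedZ n (e : k) x : Ag n x -> Ag n (e *: x).
Proof.
case: gA => /(_ n)[A0 Al] _ _ _ _ /(Al e) /(_ A0).
by rewrite addr0.
Qed.

Lemma graded_sum n I (r : seq I) (F : I -> A) :
  (forall i, Ag n (F i)) -> Ag n (\sum_(i <- r) F i).
Proof.
move=> AF; apply: big_ind => //; first exact: graded0.
by move=> x y; exact: gradedD.
Qed.

Lemma graded_polyB p q : graded_poly p -> graded_poly q -> graded_poly (p - q).
Proof.
move=> gp gq i; rewrite coefB -scaleN1r; apply: gradedD => //.
exact: gradedZ.
Qed.

Lemma graded_polyM p q : graded_poly p -> graded_poly q -> graded_poly (p * q).
Proof.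
have [_ _ _ AM _] := gA.
move=> gp gq i; rewrite coefM; apply: graded_sum => j.
by rewrite -{1}(subnKC (leq_ord j)); exact: AM.
Qed.

Lemma graded_monomial n x : Ag n x -> graded_poly (x *: 'X^n).
Proof.
move=> Ax i; rewrite coefZ coefXn; have [->|_] := eqVneq i n.
  by rewrite mulr1.
by rewrite mulr0; exact: graded0.
Qed.

Lemma graded_poly_ex x : exists2 p, graded_poly p & p.[1] = x.
Proof.
have [_ [ex _] _ _ _] := gA; have [n [f [Af ->]]] := ex x.
exists (\poly_(i < n) f i).
  by move=> i; rewrite coef_poly; case: ifP => // _; exact: graded0.
by rewrite horner_poly; apply: eq_bigr => i _; rewrite expr1n mulr1.
Qed.

(** Uniqueness of homogeneous components, applied to the difference. It turns an identity in A into
    one between coefficients. *)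
Lemma graded_poly_inj p q :
  graded_poly p -> graded_poly q -> p.[1] = q.[1] -> p = q.
Proof.
move=> gp gq epq; have gpq := graded_polyB gp gq.
have [_ [_ uniq] _ _ _] := gA.
apply/eqP; rewrite -subr_eq0; apply/eqP/polyP => i; rewrite coef0.
have [ltis|] := ltnP i (size (p - q)); last exact: nth_default.
apply: (uniq _ _ gpq _ _ ltis).
transitivity (p - q).[1].
  by rewrite horner_coef; apply: eq_bigr => j _; rewrite expr1n mulr1.
by rewrite hornerD hornerN epq subrr.
Qed.

Lemma graded0_unit x : Ag 0 x -> x <> 0 -> is_unit x.
Proof.
have [_ _ -> _ _] := gA => -[e ->] e0; exists (e^-1)%:A.
rewrite -scalerAl mul1r scalerA mulVf ?scale1r //.
by apply/eqP => e00; apply: e0; rewrite e00 scale0r.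
Qed.

(** The ideal of sums of components of degree at least n. It contains m^n, which lets membership in
    m^n be refuted by looking at degrees. *)
Definition graded_ge n : set A :=
  [set x | exists2 p, graded_poly p
    & p.[1] = x /\ forall i, (i < n)%N -> p`_i = 0].

Lemma graded_geM i j x y :
  graded_ge i x -> graded_ge j y -> graded_ge (i + j) (x * y).
Proof.
move=> [p gp [<- p0]] [q gq [<- q0]]; exists (p * q); first exact: graded_polyM.
rewrite hornerM; split=> // l lij; rewrite coefM big1 // => h _.
have [hi|ih] := ltnP h i; first by rewrite p0 ?mul0r.
rewrite q0 ?mulr0 // ltn_subLR ?leq_ord //.
by apply: leq_trans lij _; rewrite leq_add2r.
Qed.

Lemma graded_ge0 x : graded_ge 0 x.
Proof. by have [p gp px] := graded_poly_ex x; exists p. Qed.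

Lemma graded_ge_ideal n : is_ideal (graded_ge n).
Proof.
split.
  exists 0; first by move=> i; rewrite coef0; exact: graded0.
  by rewrite horner0; split=> // i _; rewrite coef0.
move=> a u v nu [q gq [<- q0]].
have [p gp [<- p0]] := graded_geM (graded_ge0 a) nu.
exists (p + q); first by move=> i; rewrite coefD; exact: gradedD.
by rewrite hornerD; split=> // i lin; rewrite coefD p0 ?q0 ?addr0.
Qed.

Lemma irrelevant_idealE : m = graded_ge 1.
Proof.
rewrite eqEsubset; split=> x.
  move=> [n [f [Af ->]]].
  (* The component [f j] has degree j + 1, whence the shift. *)
  exists (\poly_(i < n.+1) (if i is j.+1 then f j else 0)).
    move=> i; rewrite coef_poly; case: ifP => _; last exact: graded0.
    by case: i => // ; exact: graded0.
  split; last by move=> [|//] _; rewrite coef_poly.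
  rewrite horner_poly big_ord_recl mul0r add0r.
  by apply: eq_bigr => i _; rewrite expr1n mulr1.
move=> [p gp [<- p0]]; exists (size p), (fun i => p`_i.+1); split=> //.
rewrite (@horner_coef_wide _ (size p).+1) ?leqnSn // big_ord_recl.
rewrite p0 // mul0r add0r.
by apply: eq_bigr => i _; rewrite expr1n mulr1.
Qed.

Lemma ideal_pow_graded_ge n : ideal_pow m n `<=` graded_ge n.
Proof.
elim: n => [|n IHn]; first by move=> x _; exact: graded_ge0.
move=> _ [l [c [g [gP ->]]]].
apply: ideal_sum => [|i]; first exact: graded_ge_ideal.
apply: ideal_mull; first exact: graded_ge_ideal.
have [x [y [mx ny ->]]] := gP i; rewrite -add1n; apply: graded_geM.
  by rewrite -irrelevant_idealE.
exact: IHn.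
Qed.

(** The only component of x is x itself, in degree n, where elements of [graded_ge n.+1] have
    component zero. *)
Lemma graded_geN n x : Ag n x -> graded_ge n.+1 x -> x = 0.
Proof.
move=> Ax [p gp [px p0]].
have <- : (x *: 'X^n)`_n = x by rewrite coefZ coefXn eqxx mulr1.
rewrite (_ : x *: 'X^n = p) ?p0 //.
apply: graded_poly_inj => //; first exact: graded_monomial.
by rewrite px hornerZ hornerXn expr1n mulr1.
Qed.

(* If a_0 <> 0 then a and c have their lowest components in degrees 0 and n, so
   c has degree at least n and a has degree 0, that is, a lies in k. *)
Lemma homogeneous_dvd x a : is_domain A -> homogeneous Ag x -> x <> 0 ->
  multiples a x -> ~ is_unit a -> m a.
Proof.
move=> dA [n Ax] x0 [c xE] anu; rewrite irrelevant_idealE.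
have [p gp pa] := graded_poly_ex a; have [q gq qc] := graded_poly_ex c.
exists p => //; split=> // -[|//] _; apply: contrapT => p0.
have qpE : q * p = x *: 'X^n.
  apply: graded_poly_inj; [exact: graded_polyM|exact: graded_monomial|].
  by rewrite hornerM qc pa hornerZ hornerXn expr1n mulr1.
have q0 : q != 0.
  by apply/eqP => q0; apply: x0; rewrite xE -qc q0 horner0 mul0r.
have qn0 : q`_n <> 0.
  (* Let i be the least index with q_i nonzero. The coefficient of qp in degree i is q_i p_0, which
     is nonzero, whereas qp is concentrated in degree n; so i = n. *)
  have [i qi0 imin] : exists2 i, q`_i != 0 & forall j, (j < i)%N -> q`_j = 0.
    have ex : exists i, q`_i != 0.
      by exists (size q).-1; rewrite -lead_coefE lead_coef_eq0.
    case: (ex_minnP ex) => i qi0 imin; exists i => // j ji; apply/eqP.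
    by apply/negPn/negP => /imin; rewrite leqNgt ji.
  suff <- : i = n by apply/eqP.
  apply/eqP; apply: contrapT => /negP ni.
  have : (q * p)`_i = 0 by rewrite qpE coefZ coefXn (negPf ni) mulr0.
  rewrite coefM big_ord_recr /= subnn big1 ?add0r => [|j _].
    by move=> /(domain_mul0 dA)[/eqP|//]; exact/negP.
  by rewrite imin ?mul0r.
have lt_n : (n < size q)%N.
  by rewrite ltnNge; apply/negP => /(nth_default 0).
have lp0 : p != 0 by apply/eqP => pp; apply: p0; rewrite pp coef0.
(* The leading coefficients have nonzero product in the domain A, so degrees add up. *)
have sqp : size (q * p) = (size q + size p).-1.
  apply: size_proper_mul; apply/eqP => /(domain_mul0 dA)[]/eqP;
    by rewrite lead_coef_eq0; exact/negP.
have sp : (size p <= 1)%N.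
  have : (size (q * p)%R <= n.+1)%N.
    by rewrite qpE (leq_trans (size_scale_leq _ _)) // size_polyXn.
  rewrite sqp; move: lt_n; case: (size p) => // s; rewrite addnS /= => lt_n le_n.
  have := leq_trans (leq_add lt_n (leqnn s)) le_n.
  by rewrite -[X in (_ <= X)%N]addn0 leq_add2l leqn0 => /eqP ->.
apply: anu; rewrite -pa (size1_polyC sp) hornerC; exact: graded0_unit.
Qed.

End Graded.

(** * Ideals of k[X] and prime chains in its quotients *)

Section PolynomialImage.
Context {k : fieldType}.

(** Euclidean division by a nonzero element of least size. *)
Lemma poly_ideal_principal (I : set {poly k}) f : is_ideal I -> I f -> f <> 0 ->
  exists2 g, g != 0 & I = multiples g.
Proof.
move=> iI If /eqP f0.
have ex : exists n, `[< exists g, [/\ I g, g != 0 & size g = n] >].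
  by exists (size f); apply/asboolP; exists f.
case: (ex_minnP ex) => n /asboolP[g [Ig g0 sg]] nmin.
exists g => //; rewrite eqEsubset; split=> [h Ih|]; last exact: multiples_sub.
exists (h %/ g); rewrite [LHS](divp_eq h g).
suff -> : h %% g = 0 by rewrite addr0.
apply/eqP/negPn/negP => r0.
have Ir : I (h %% g).
  have -> : h %% g = h - h %/ g * g.
    by rewrite {2}(divp_eq h g) addrAC subrr add0r.
  by apply: idealB => //; exact: ideal_mull.
have : (n <= size (h %% g)%R)%N by apply: nmin; apply/asboolP; exists (h %% g).
by rewrite -sg leqNgt ltn_modp g0.
Qed.

(** Quotients of k[X] have dimension at most 1. The preimages of [c 1] and [c 2] are (g) and (h)
    with g = eh, and primality of [c 1] puts e or h in (g): the first makes h a unit, the second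
    gives [c 2] inside [c 1]. *)
Lemma poly_image_no_prime_chain2 (A : comNzRingType)
    (phi : {rmorphism {poly k} -> A})
    (c : nat -> set A) :
  (forall x, exists p, x = phi p) -> ~ prime_chain 2 c.
Proof.
move=> surj [cp cs].
have ipre i : (i <= 2)%N -> is_ideal (phi @^-1` c i).
  move=> /cp[[c0 ci] _ _]; split; first by rewrite /= rmorph0.
  by move=> a u v /= cu cv; rewrite rmorphD rmorphM; exact: ci.
have [[i0 _] _ _] := cp 0%N isT; have [_ c1N c1M] := cp 1%N isT.
have [_ c2N _] := cp 2%N isT.
have [sub12 nsub21] := cs 1%N isT; have [_ nsub10] := cs 0%N isT.
(* Strictness of [c 0] in [c 1] makes the preimage of [c 1] nonzero. *)
have [f c1f f0] : exists2 f, c 1%N (phi f) & f <> 0.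
  apply: contrapT => nof; apply: nsub10 => x.
  have [f ->] := surj x => c1f; have [->|/eqP f0] := eqVneq f 0.
    by rewrite rmorph0.
  by case: nof; exists f.
have [g g0 gE] := poly_ideal_principal (ipre 1%N isT) c1f f0.
have [h h0 hE] := poly_ideal_principal (ipre 2%N isT) (sub12 _ c1f) f0.
have c1g : c 1%N (phi g).
  by rewrite -[c _ _]/((phi @^-1` c 1%N) g) gE; exact: multiples_id.
have [e geh] : multiples h g by rewrite -hE; exact: sub12.
move: c1g; rewrite geh rmorphM => /c1M[c1e|c1h].
  have [r re] : multiples g e by rewrite -gE.
  apply: c2N; rewrite -(rmorph1 phi) -[c _ _]/((phi @^-1` c 2%N) 1) hE.
  exists r; apply: (mulIf g0); by rewrite mul1r {1}geh re mulrAC.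
apply: nsub21 => x; have [p ->] := surj x.
rewrite -[c _ _]/((phi @^-1` c 2%N) p) hE => -[r ->].
by rewrite rmorphM; apply: ideal_mull => //; case: (cp 1%N isT).
Qed.

End PolynomialImage.

Lemma infinite_setT_inj (T : Type) : infinite_set [set: T] ->
  exists e : nat -> T, injective e.
Proof.
elim/Ppointed: T => T; first by rewrite emptyE => /(_ (finite_set0 _)).
move=> /infiniteP/pcard_injP[e einj].
by exists e => i j; apply: einj; rewrite inE.
Qed.

(** * Independent linear forms, and alpha in the graded case *)

Section GradedAlpha.
Context {k : fieldType} {A : comAlgType k} (Ag : nat -> set A)
  (gA : standard_graded Ag).

(** The polynomials in a form a subalgebra, and it contains the degree-one generators of A. *)
Lemma standard_graded_generated (a : A) :
  (forall x, Ag 1 x -> exists e : k, x = e *: a) ->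
  forall x, exists p, x = horner_alg a p.
Proof.
move=> A1a x; have [_ _ _ _ [s [sA1 gen]]] := gA.
pose B : {pred A} := fun x => `[< exists p, x = horner_alg a p >].
suff /asboolP : x \in B by [].
apply: (gen B) => [|y /sA1 /A1a[e ->]]; last first.
  apply/asboolP; exists (e%:P * 'X).
  by rewrite rmorphM /= horner_algC horner_algX mulr_algl.
split.
- by apply/asboolP; exists 1; rewrite rmorph1.
- move=> e _ _ /asboolP[p ->] /asboolP[q ->].
  apply/asboolP; exists (e%:P * p + q).
  by rewrite rmorphD rmorphM /= horner_algC mulr_algl.
- move=> _ _ /asboolP[p ->] /asboolP[q ->].
  by apply/asboolP; exists (p * q); rewrite rmorphM.
Qed.

Lemma alpha_graded (R : realType) d : infinite_set [set: k] ->
  is_UFD A -> krull_dim A d -> (2 <= d)%N ->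
  is_domain (assoc_graded (irrelevant_ideal Ag)) ->
  alpha R (irrelevant_ideal Ag) (homogeneous Ag) = 1%:E.
Proof.
move=> infk ufdA [[c [cp cs]] _] d2 dG; have dA := UFD_domain ufdA.
(* If a spanned the degree-one part, A would be an image of k[X] and could not have a chain of three
   primes. Used first with 0, then with the element so found, this yields two independent
   elements. *)
have A1span a : exists2 b, Ag 1 b & forall e : k, b <> e *: a.
  apply: contrapT => nob.
  apply: (@poly_image_no_prime_chain2 k A (horner_alg a) c).
    apply: standard_graded_generated => x Ax; apply: contrapT => nox.
    by apply: nob; exists x => // e xE; apply: nox; exists e.
  split=> i i2; first by apply: cp; exact: leq_trans d2.
  by apply: cs; exact: leq_trans d2.
have [a Aa a0] := A1span 0; have [b Ab ba] := A1span a.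
have {}a0 : a != 0 by apply/eqP; rewrite -(scaler0 _ 1).
have indep (s t : k) : s *: a = t *: b -> s = 0 /\ t = 0.
  have [->|t0] := eqVneq t 0.
    by rewrite scale0r => /eqP; rewrite scaler_eq0 (negPf a0) orbF => /eqP.
  move=> stE; case: (ba (t^-1 * s)).
  by rewrite -scalerA stE scalerA mulVf // scale1r.
have [e einj] : exists e : nat -> k, injective e.
  exact: infinite_setT_inj.
pose y i := a + e i *: b.
have Ay i : Ag 1 (y i) by apply: gradedD => //; exact: gradedZ.
have y0 i : y i <> 0.
  move=> /eqP; rewrite addr_eq0 -scaleNr -[a]scale1r => /eqP/indep[/eqP].
  by rewrite oner_eq0.
apply: (alpha_eq1 (y := y) ufdA dG).
- by exists 0%N; have [_ _ -> _ _] := gA; exists 1; rewrite scale1r.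
- move=> u v [i Au] [j Av]; exists (i + j)%N.
  by have [_ _ _ AM _] := gA; exact: AM.
- by move=> x u hx x0; apply: homogeneous_dvd hx x0.
- move=> i; split; first by exists 1%N.
    rewrite (irrelevant_idealE gA); exists (y i *: 'X).
      by rewrite -['X]expr1; exact: graded_monomial.
    rewrite hornerZ hornerX mulr1; split=> // -[|//] _.
    by rewrite coefZ coefX mulr0.
  (* No nonzero element of degree one lies in m^2. *)
  by move=> /(ideal_pow_graded_ge gA) /(graded_geN gA (Ay i))/y0.
(* Associates of degree one differ by a scalar t, the degree-zero component of u; independence of a
   and b then forces t = 1 and e i = e j. *)
- move=> i j [u [_ yE]]; have [p gp pu] := graded_poly_ex gA u.
  have pyE : y j *: 'X^1 = p * (y i *: 'X^1).
    apply: (graded_poly_inj gA); [exact: graded_monomial| |].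
      by apply: graded_polyM => //; exact: graded_monomial.
    by rewrite hornerM pu !hornerZ !hornerXn expr1n !mulr1.
  have [t pt] : exists t : k, p`_0 = t%:A.
    have := gp 0%N; have [_ _ -> _ _] := gA; exact.
  have yjE : y j = t *: y i.
    have /(congr1 (fun q : {poly A} => q`_1)) := pyE.
    rewrite -scalerAr !coefZ coefMXn coefXn /= pt !mulr1 => ->.
    by rewrite -scalerAr mulr1.
  have /indep[/eqP t1 /eqP et] : (1 - t) *: a = (t * e i - e j) *: b.
    apply/eqP; rewrite !scalerBl scale1r subr_eq addrAC eq_sym subr_eq eq_sym.
    by rewrite -/(y j) yjE scalerDr scalerA addrC.
  move: t1 et; rewrite subr_eq0 => /eqP <-.
  by rewrite mul1r subr_eq0 => /eqP/einj.
Qed.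

End GradedAlpha.

Theorem proposition1p1 (R : realType) :
  (forall (A : comNzRingType) (m : set A) (d : nat),
     noetherian A ->
     is_local m ->
     is_UFD A ->
     krull_dim A d -> (2 <= d)%N ->
     is_domain (assoc_graded m) ->
     alpha R m setT = 1%:E)
  /\
  (forall (k : fieldType) (A : comAlgType k) (Ag : nat -> set A) (d : nat),
     infinite_set [set: k] ->
     standard_graded Ag ->
     is_UFD A ->
     krull_dim A d -> (2 <= d)%N ->
     is_domain (assoc_graded (irrelevant_ideal Ag)) ->
     alpha R (irrelevant_ideal Ag) (homogeneous Ag) = 1%:E).
Proof.
split=> [A m d|k A Ag d infk gA]; first exact: alpha_local.
exact: alpha_graded.
Qed.
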